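(* Let $\Bbbk$ be a field of characteristic $2$ and let $G$ be a finite simple graph. Then $G$ is weakly closed if and only if the quotient ring $R_G$ of its binomial edge ideal over $\Bbbk$ is F-pure.
   Context: Graphs are finite and simple (no loops, no repeated edges). For a graph $G$ on vertex set $[n]=\{1,\dots,n\}$ and a field $\Bbbk$, let $R=\Bbbk[x_1,\dots,x_n,y_1,\dots,y_n]$ and $f_{i,j}=x_iy_j-x_jy_i$. The binomial edge ideal of $G$ is $J_G=(f_{i,j}\mid \{i,j\}\in E(G))\subseteq R$, and $R_G=R/J_G$. A graph $G$ on $n$ vertices is weakly closed if there is a labeling of its vertices by $1,\dots,n$ (a bijection with $[n]$) such that for every edge $\{i,j\}$ with $i<j$ and every integer $k$ with $i<k<j$, either $\{i,k\}\in E(G)$ or $\{k,j\}\in E(G)$. A ring $A$ of prime characteristic $p>0$ is F-pure if the Frobenius map $F:A\to F_*A$, $r\mapsto F_*r^p$, is a pure map of $A$-modules, i.e. $M\to M\otimes_A F_*A$ is injective for every $A$-module $M$. Here $F_*A$ is $A$ regarded as an $A$-module via $r\cdot F_*s=F_*(r^ps)$. *)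

(* Defs.v *)
From HB Require Import structures.
From mathcomp Require Import all_boot all_order all_fingroup all_algebra.
From mathcomp Require Import generic_quotient ring_quotient.
From mathcomp Require Import boolp.
From mathcomp Require Import freeg mpoly.

Set Implicit Arguments.
Unset Strict Implicit.
Unset Printing Implicit Defensive.

Import GRing.Theory.
Local Open Scope ring_scope.
Local Open Scope quotient_scope.

Section TensorProduct.
Variables (A : comNzRingType) (M N : lmodType A).

(* The subgroup of the free abelian group on [M * N] generated by the
   bilinearity relations. *)
Inductive tensor_relation : {freeg (M * N)%type / int} -> Prop :=
| tensor_rel0 : tensor_relation 0
| tensor_relB u v :
    tensor_relation u -> tensor_relation v -> tensor_relation (u - v)
| tensor_relDl (m1 m2 : M) (n : N) :
    tensor_relation (<< (m1 + m2, n) >> - << (m1, n) >> - << (m2, n) >>)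
| tensor_relDr (m : M) (n1 n2 : N) :
    tensor_relation (<< (m, n1 + n2) >> - << (m, n1) >> - << (m, n2) >>)
| tensor_relZ (a : A) (m : M) (n : N) :
    tensor_relation (<< (a *: m, n) >> - << (m, a *: n) >>).

Definition tensor_pred : {pred {freeg (M * N)%type / int}} :=
  fun u => `[< tensor_relation u >].

Fact tensor_pred_zmod_closed : zmod_closed tensor_pred.
Proof.
split=> [|u v]; first exact/asboolP/tensor_rel0.
by move=> /asboolP hu /asboolP hv; apply/asboolP/tensor_relB.
Qed.

HB.instance Definition _ :=
  GRing.isZmodClosed.Build {freeg (M * N)%type / int} tensor_pred
    tensor_pred_zmod_closed.

(* Only the underlying abelian group of the tensor product is constructed:
   injectivity of a map into it does not involve the scalar action. *)
Definition tensor : zmodType := Quotient.quot tensor_pred.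

Definition tensor_pure (m : M) (n : N) : tensor :=
  \pi_(Quotient.quot tensor_pred) << (m, n) >>.

End TensorProduct.

(* Through the identification of [M] with its tensor product with [A], the map
   induced by [phi] on [M] sends [m] to [m] tensored with [phi 1]. *)
Definition pure_map (A : comNzRingType) (N : lmodType A)
    (phi : {linear A^o -> N}) : Prop :=
  forall M : lmodType A, injective (fun m : M => tensor_pure m (phi 1)).

Section Frobenius.
Variables (A : comNzRingType) (p : nat) (charAp : p \in [pchar A]).

Definition frobenius_pushforward of p \in [pchar A] : Type := A.
Local Notation "'F_*A'" := (frobenius_pushforward charAp).

HB.instance Definition _ := GRing.Zmodule.on F_*A.

Definition frobenius_scale (r : A) (s : F_*A) : F_*A := r ^+ p * (s : A).

Fact frobenius_scaleA a b v :
  frobenius_scale a (frobenius_scale b v) = frobenius_scale (a * b) v.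
Proof. by rewrite /frobenius_scale mulrA exprMn. Qed.

Fact frobenius_scale1 : left_id 1 frobenius_scale.
Proof. by move=> v; rewrite /frobenius_scale expr1n mul1r. Qed.

Fact frobenius_scaleDr : right_distributive frobenius_scale +%R.
Proof. by move=> a u v; exact: mulrDr. Qed.

Fact frobenius_scaleDl v : {morph frobenius_scale^~ v : a b / a + b}.
Proof.
move=> a b; rewrite /frobenius_scale -!(pFrobenius_autE charAp) rmorphD /=.
exact: mulrDl.
Qed.

HB.instance Definition _ := GRing.Zmodule_isLmodule.Build A F_*A
  frobenius_scaleA frobenius_scale1 frobenius_scaleDr frobenius_scaleDl.

Definition frobenius_map (r : A^o) : F_*A := (r : A) ^+ p.

Fact frobenius_map_linear : linear frobenius_map.
Proof.
move=> a u v; rewrite /frobenius_map -!(pFrobenius_autE charAp).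
by rewrite rmorphD rmorphM.
Qed.

HB.instance Definition _ :=
  GRing.isLinear.Build A A^o F_*A _ frobenius_map frobenius_map_linear.

Definition F_pure : Prop := pure_map frobenius_map.

End Frobenius.

Record simple_graph (n : nat) := SimpleGraph {
  edge :> rel 'I_n;
  edge_sym : ssrbool.symmetric edge;
  edge_irrefl : irreflexive edge
}.

Definition weakly_closed (n : nat) (G : simple_graph n) : Prop :=
  exists2 label : 'I_n -> 'I_n, bijective label &
    forall u v w : 'I_n, edge G u v ->
      (label u < label w)%N -> (label w < label v)%N ->
      edge G u w \/ edge G w v.

Section BinomialEdgeIdeal.
Variables (k : fieldType) (n : nat) (G : simple_graph n).
Local Notation R := {mpoly k[n + n]}.

Definition xvar (i : 'I_n) : R := 'X_(lshift n i).
Definition yvar (i : 'I_n) : R := 'X_(rshift n i).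

Definition edge_binomial (i j : 'I_n) : R :=
  xvar i * yvar j - xvar j * yvar i.

(* Each edge occurs in both orientations, which is harmless as
   [edge_binomial j i = - edge_binomial i j]. *)
Definition binomial_edge_ideal : {pred R} :=
  fun q => `[< exists c : 'I_n -> 'I_n -> R,
    q = \sum_i \sum_(j | edge G i j) c i j * edge_binomial i j >].

Fact binomial_edge_idealr_closed : idealr_closed binomial_edge_ideal.
Proof.
split.
- apply/asboolP; exists (fun _ _ => 0).
  by rewrite big1 // => i _; rewrite big1 // => j _; rewrite mul0r.
- apply/negP => /asboolP[c] /(congr1 (meval (fun=> 0))) /eqP.
  rewrite rmorph1 rmorph_sum /= big1 ?oner_eq0 // => i _.
  rewrite rmorph_sum big1 //= => j _.
  by rewrite rmorphM rmorphB !rmorphM /= !mevalXU !mulr0 subrr mulr0.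
- move=> a u v /asboolP[c ->] /asboolP[d ->]; apply/asboolP.
  exists (fun i j => a * c i j + d i j).
  rewrite mulr_sumr -big_split; apply: eq_bigr => i _ /=.
  rewrite mulr_sumr -big_split; apply: eq_bigr => j _ /=.
  by rewrite mulrDl mulrA.
Qed.

HB.instance Definition _ :=
  isIdealr.Build R binomial_edge_ideal binomial_edge_idealr_closed.

Definition binomial_edge_ring : comNzRingType :=
  {ideal_quot binomial_edge_ideal}.

Lemma binomial_edge_ring_pchar (p : nat) :
  p \in [pchar k] -> p \in [pchar binomial_edge_ring].
Proof.
move=> /(rmorph_pchar (@mpolyC (n + n) k)).
exact: (rmorph_pchar (\pi_{ideal_quot binomial_edge_ideal})).
Qed.

End BinomialEdgeIdeal.

(* Main.v *)
Require Import Defs.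
From mathcomp Require Import all_boot all_order all_fingroup all_algebra.
From HB Require Import structures.
From mathcomp Require Import generic_quotient ring_quotient.
From mathcomp Require Import boolp freeg mpoly.
From mathcomp Require classical_sets.
From mathcomp Require Import zify ring.

(** Write [f_(i,j)] for the binomial of [i] and [j], [J] for the binomial edge
    ideal and [J2] for the ideal generated by the squares of its generators.

    Weakly closed implies F-pure. List the vertices as [v1, ..., vn] in the order
    of the labels and set
    [u = y_v1 * f_(v1,v2) * f_(v2,v3) * ... * f_(v(n-1),vn) * x_vn].
    Pluecker relations show that [u * f_(i,j)] lies in [J2] for every edge [ij]
    ([chain_in_squares]): the vertices between [i] and [j] are removed from the
    chain one by one, each at the cost of a multiple of the square of an edge
    binomial, because each is adjacent to [i] or to [j]. As [u] has degree two in
    each pair [x_v], [y_v], its only monomial with all exponents odd is the product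
    of all the variables, and its coefficient is [1]. Let [trace] be the map that
    keeps the monomials with all exponents odd, divides them by the product of the
    variables and takes a square root. Then [g |-> trace (u * g)] preserves [J], and
    the map that it induces on the quotient ring splits the Frobenius map
    ([weakly_closed_trace], [weakly_closed_F_pure]). This is one half of Fedder's
    criterion; a projection of the field onto its squares, found by Zorn's lemma,
    makes it work over an arbitrary field of characteristic 2.

    F-pure implies weakly closed. A graph is weakly closed when the graph [H] of its
    nonadjacent pairs has a transitive orientation: any linear extension is then a
    suitable labeling. By a theorem of Ghouila-Houri, [H] has a transitive
    orientation as soon as no forcing class of ordered pairs contains both [(a, b)]
    and [(b, a)] ([oriented_trans]). To see that F-purity excludes such a class,
    purity is tested on the module of additive maps from the quotient ring to the
    field. Attach to a nonadjacent pair the tensor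
    [t_(a,b) = (x_a y_b)^* (x) x_a y_a x_b y_b], where the first factor takes the
    coefficient of [x_a y_b]. It is constant on forcing classes ([fork_tensor]),
    and [t_(a,b) + t_(b,a) = 1^* (x) 1] when [a] and [b] lie in one component of the
    graph ([connected_pair_tensor]); two pairs in one forcing class have their first
    vertices in one component, and their second vertices as well. If [(a, b)] and
    [(b, a)] were in one class, then
    [1^* (x) 1 = t_(a,b) + t_(a,b) = 0] as the characteristic is 2, although [1^*]
    is not zero, so that the Frobenius map would not be pure. *)

Set Implicit Arguments.
Unset Strict Implicit.
Unset Printing Implicit Defensive.

Import GRing.Theory.

(** * Transitive orientations and linear extensions *)

Section TransitiveOrientation.
Variables (T : finType) (H : rel T).
Hypothesis H_sym : ssrbool.symmetric H.

(** In a transitive orientation, two edges [xy] and [xz] with [yz] not an edge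
    must both leave [x] or both enter [x]: this is the forcing relation of
    Gallai and Golumbic, on ordered pairs. *)
Definition forces : rel (T * T) := fun a b =>
  [&& H a.1 a.2, H b.1 b.2
   & (a.1 == b.1) && ~~ H a.2 b.2 || (a.2 == b.2) && ~~ H a.1 b.1].

Definition same_class := connect forces.

Definition flip (a : T * T) := (a.2, a.1).

Lemma forces_sym : ssrbool.symmetric forces.
Proof.
move=> a b; rewrite /forces andbCA (eq_sym b.1) (eq_sym b.2) (H_sym b.2).
by rewrite (H_sym b.1 a.1).
Qed.

Lemma same_class_sym : ssrbool.symmetric same_class.
Proof. by apply: sym_connect_sym; exact: forces_sym. Qed.

Lemma forces_flip a b : forces a b -> forces (flip a) (flip b).
Proof.
by rewrite /forces /= [in X in _ -> X]orbC (H_sym a.1) (H_sym b.1).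
Qed.

Lemma same_class_flip a b : same_class a b -> same_class (flip a) (flip b).
Proof.
case/connectP=> p; elim: p a => [|c p IHp] a /= => [_ lb|/andP[ac cp] lb].
  by subst b; exact: connect0.
exact: connect_trans (connect1 (forces_flip ac)) (IHp _ cp lb).
Qed.

Lemma same_class_edge a b : same_class a b -> H a.1 a.2 -> H b.1 b.2.
Proof.
case/connectP=> p; elim: p a => [|c p IHp] a /= => [_ -> //|/andP[ac cp] lb _].
by apply: IHp cp lb _; case/and3P: ac.
Qed.

(** Lexicographic rank of an ordered pair. *)
Definition code (a : T * T) : nat := enum_rank a.1 * #|T| + enum_rank a.2.

Lemma code_inj : injective code.
Proof.
move=> [a b] [c d]; rewrite /code /= => E.
have T_gt0 : 0 < #|T| by apply: leq_ltn_trans (ltn_ord (enum_rank a)).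
have E1 : enum_rank a = enum_rank c :> nat.
  move/(congr1 (divn^~ #|T|)): E.
  by rewrite !divnMDl // !divn_small ?ltn_ord // !addn0.
move: E; rewrite E1 => /addnI /ord_inj/enum_rank_inj ->.
by move/ord_inj/enum_rank_inj: E1 => ->.
Qed.

Lemma leq_code a b : code a <= code b -> enum_rank a.1 <= enum_rank b.1.
Proof.
have T_gt0 : 0 < #|T| by apply: leq_ltn_trans (ltn_ord (enum_rank a.1)).
move/(leq_div2r #|T|); rewrite /code !divnMDl //.
by rewrite !divn_small ?ltn_ord // !addn0.
Qed.

Definition leader a := [arg min_(b < a | same_class a b) code b].

Lemma leaderP a :
  same_class a (leader a) /\ forall b, same_class a b -> code (leader a) <= code b.
Proof. by rewrite /leader; case: arg_minnP => //; exact: connect0. Qed.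

Lemma eq_leader a b : same_class a b -> leader a = leader b.
Proof.
move=> ab; have [am minA] := leaderP a; have [bm minB] := leaderP b.
apply/code_inj/eqP; rewrite eqn_leq minA ?minB //.
  by apply: connect_trans am; rewrite -/same_class same_class_sym.
exact: connect_trans bm.
Qed.

(** Among a forcing class and its reversal, the class with the
    lexicographically smaller element is chosen: this lexicographic rule is what
    makes the orientation transitive, whereas arbitrary choices, class by class,
    may create directed triangles. *)
Definition oriented x y := H x y && (code (leader (x, y)) < code (leader (y, x))).

Lemma oriented_class x y x' y' :
  same_class (x, y) (x', y') -> oriented x y -> oriented x' y'.
Proof.
move=> xy /andP[Hxy lt_xy]; rewrite /oriented (same_class_edge xy Hxy) /=.
by rewrite -(eq_leader xy) -(eq_leader (same_class_flip xy)).
Qed.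

Lemma oriented_asym x y : oriented x y -> ~~ oriented y x.
Proof. by case/andP=> _ lt_xy; rewrite negb_and -leqNgt ltnW ?orbT. Qed.

Lemma oriented_step x y x' y' :
  forces (x, y) (x', y') -> oriented x y -> oriented x' y'.
Proof. by move=> xy; apply/oriented_class/connect1. Qed.

Lemma oriented_edge x y : oriented x y -> H x y.
Proof. by case/andP. Qed.

(** The triangle lemma: an edge of a directed triangle can be replaced by any
    edge of its class, the opposite vertex being kept. One forcing step moves one
    end of the edge; were the new end not joined to the opposite vertex, the moved
    edge would force another edge of the triangle against its orientation. *)
Lemma directed_triangle a b c b' c' :
    oriented a b -> oriented b c -> oriented c a ->
    same_class (b, c) (b', c') ->
  same_class (a, b) (a, b') /\ same_class (c, a) (c', a).
Proof.
move=> ab bc ca /connectP[p].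
elim: p b c ab bc ca => [|[b1 c1] p IHp] b c ab bc ca /= => [_ [-> ->]|].
  by split; exact: connect0.
case/andP=> bc1 cp lb; have /and3P[/= Hbc Hbc1 step] := bc1.
have b1c1 := oriented_step bc1 bc.
have [Hab Hca] := (oriented_edge ab, oriented_edge ca).
case/orP: step => /andP[/eqP E nH]; subst.
- have Hac1 : H a c1.
    apply: contraT => nHac1; have := oriented_asym ab.
    rewrite (@oriented_step b1 c1) // /forces /= eqxx Hbc1 (H_sym b1) Hab.
    by rewrite (H_sym c1) nHac1.
  have cac1 : forces (c, a) (c1, a).
    by rewrite /forces /= eqxx Hca (H_sym c1) Hac1 nH orbT.
  have [//|E1 E2] := IHp b1 c1 ab b1c1 (oriented_step cac1 ca) cp.
  by split=> //; apply: connect_trans (connect1 cac1) E2.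
- have Hab1 : H a b1.
    apply: contraT => nHab1; have := oriented_asym ca.
    rewrite (@oriented_step b1 c1) // /forces /= eqxx Hbc1 (H_sym a) Hca.
    by rewrite (H_sym b1) nHab1 orbT.
  have abb1 : forces (a, b) (a, b1).
    by rewrite /forces /= eqxx Hab Hab1 nH.
  have [//|E1 E2] := IHp b1 c1 (oriented_step abb1 ab) b1c1 ca cp.
  by split=> //; apply: connect_trans (connect1 abb1) E1.
Qed.

Hypothesis H_coherent : forall x y, H x y -> ~~ same_class (x, y) (y, x).

Lemma oriented_total x y : H x y -> oriented x y || oriented y x.
Proof.
move=> Hxy; rewrite /oriented (H_sym y) Hxy /= -neq_ltn.
apply: contra (H_coherent Hxy) => /eqP/code_inj E.
have [xm _] := leaderP (x, y); have [ym _] := leaderP (y, x).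
by apply: connect_trans xm _; rewrite E -/same_class same_class_sym.
Qed.

(** Suppose that the lexicographically least pair [(b', c')] of the three classes
    of a directed triangle lies in the class of [(b, c)]. By the triangle lemma the
    triangle may be taken to be [a], [b'], [c']. The class of [(a, b')] was chosen
    over its reversal, which contains [(b', a)], so it has an element [(b', v)];
    transporting the triangle along that element gives the edge [b' c'] both
    orientations. *)
Lemma no_directed_triangle_min a b c :
    oriented a b -> oriented b c -> oriented c a ->
    code (leader (b, c)) <= code (leader (a, b)) ->
    code (leader (b, c)) <= code (leader (c, a)) -> False.
Proof.
move=> ab bc ca le_ab le_ca.
have [] := leaderP (b, c); case def_l: (leader _) => [b' c'] bc' min_bc.
have [ab' ca'] := directed_triangle ab bc ca bc'.
have {}ab := oriented_class ab' ab; have {}bc := oriented_class bc' bc.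
have {}ca := oriented_class ca' ca.
rewrite (eq_leader ab') (eq_leader ca') def_l in le_ab le_ca.
have [] := leaderP (a, b'); case def_v: (leader _) => [u v] uv min_uv.
rewrite def_v in le_ab.
(* The leader of the class of [(a, b')] starts at [b']: not later, since
   [(b', a)] lies in the reversed class, and not earlier, by minimality. *)
have le_ub : enum_rank u <= enum_rank b'.
  case/andP: ab => _; rewrite def_v => /ltnW lt.
  have [_ min_ba] := leaderP (b', a).
  exact: leq_code (leq_trans lt (min_ba _ (connect0 _ _))).
have E : u = b'.
  apply/enum_rank_inj/val_inj/eqP; rewrite eqn_leq le_ub.
  exact: leq_code le_ab.
subst u.
have [c'b' _] := directed_triangle ca ab bc uv.
by have := oriented_asym bc; rewrite (oriented_class c'b' ca).
Qed.

Lemma no_directed_triangle a b c :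
  oriented a b -> oriented b c -> oriented c a -> False.
Proof.
move=> ab bc ca.
set x := code (leader (a, b)); set y := code (leader (b, c)).
set z := code (leader (c, a)).
have [le_yx|lt_xy] := leqP y x.
  have [le_yz|/ltnW le_zy] := leqP y z.
    exact: (@no_directed_triangle_min a b c).
  by apply: (@no_directed_triangle_min b c a) => //; apply: leq_trans le_yx.
have [le_xz|/ltnW le_zx] := leqP x z.
  by apply: (@no_directed_triangle_min c a b) => //; apply: ltnW.
apply: (@no_directed_triangle_min b c a) => //.
exact: leq_trans le_zx (ltnW lt_xy).
Qed.

(** If [x -> y -> z] and [xz] is not an edge, then [xy] forces [zy], against the
    orientation of [yz]; otherwise [xz] is oriented, and not from [z] to [x]. *)
Lemma oriented_trans : transitive oriented.
Proof.
move=> y x z xy yz; have [Hxy Hyz] := (oriented_edge xy, oriented_edge yz).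
have [Hxz|nHxz] := boolP (H x z).
  have /orP[//|zx] := oriented_total Hxz.
  by case: (no_directed_triangle xy yz zx).
have := oriented_asym yz; rewrite (@oriented_step x y z y) //.
by rewrite /forces /= eqxx Hxy (H_sym z) Hyz nHxz orbT.
Qed.

End TransitiveOrientation.

(** Sorting by the number of predecessors, with ties broken by the index. *)
Lemma linear_extension n (P : rel 'I_n) : irreflexive P -> transitive P ->
  exists2 label : 'I_n -> 'I_n, bijective label &
    forall x y, P x y -> label x < label y.
Proof.
move=> P_irr P_trans.
pose height x := #|[set z | P z x]|.
pose c (x : 'I_n) : nat := height x * n + x.
have c_inj : injective c.
  move=> x y E; apply/ord_inj; have n_gt0 := leq_ltn_trans (leq0n _) (ltn_ord x).
  move/(congr1 (modn^~ n)): E.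
  by rewrite /c !modnMDl !modn_small.
have P_c x y : P x y -> c x < c y.
  move=> Pxy; have lt_h : height x < height y.
    apply/proper_card/properP; split.
      by apply/subsetP=> z; rewrite !inE => /P_trans/(_ Pxy).
    by exists x; rewrite !inE ?P_irr.
  rewrite /c; apply: leq_trans (leq_addr y _).
  apply: leq_trans (leq_mul lt_h (leqnn n)).
  by rewrite mulSn addnC ltn_add2r.
have rank_lt x : #|[set z | c z < c x]| < n.
  rewrite -[X in _ < X]card_ord; apply/proper_card/properP; split.
    by apply/subsetP.
  by exists x; rewrite // !inE ltnn.
pose label x := Ordinal (rank_lt x).
have label_mono x y : c x < c y -> label x < label y.
  move=> lt_xy; apply/proper_card/properP; split.
    by apply/subsetP=> z; rewrite !inE => /ltn_trans; apply.
  by exists x; rewrite !inE ?ltnn.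
exists label => [|x y /P_c/label_mono //].
apply: injF_bij => x y E; apply: c_inj.
by case: (ltngtP (c x) (c y)) => // /label_mono; rewrite E ltnn.
Qed.

Local Open Scope ring_scope.
Local Open Scope quotient_scope.

(** * Chains of brackets and Pluecker relations *)

Section Chains.
Variable R : comNzRingType.
Implicit Types (p q a b i j w : R * R) (s : seq (R * R)).

Definition bracket p q : R := p.1 * q.2 - q.1 * p.2.

Fixpoint chain p s : R :=
  if s is q :: s' then bracket p q * chain q s' else 1.

Lemma chain_cat p s t : chain p (s ++ t) = chain p s * chain (last p s) t.
Proof. by elim: s p => [|q s IHs] p /=; rewrite ?mul1r // IHs mulrA. Qed.

Lemma chain_rcons p s q : chain p (rcons s q) = chain p s * bracket (last p s) q.
Proof. by rewrite -cats1 chain_cat /= mulr1. Qed.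

(** This is the Pluecker relation for [i], [j] and the first and last inner
    points. *)
Lemma chain_swap_ends i j s w :
  exists r, bracket i j * chain i (rcons (rcons s w) j) =
    bracket i j * chain j (rcons (rcons s w) i) + r * bracket i j ^+ 2.
Proof.
have [v [t ->]] : exists v t, rcons s w = v :: t.
  by exists (head w s), (behead (rcons s w)); rewrite -headI.
exists (bracket (last v t) v * chain v t).
rewrite /= !chain_rcons /bracket; ring.
Qed.

(** [K] stands for membership in an ideal. *)
Variable K : R -> Prop.
Hypotheses (K_add : forall f g, K f -> K g -> K (f + g))
           (K_mul : forall f g, K f -> K (g * f)).

(** The Pluecker relation for the last three points before [b], multiplied by
    [bracket w j], bypasses [w] up to a multiple of [bracket w j ^+ 2]; the factor
    [bracket w j] then takes over the role of [bracket j b]. *)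
Lemma chain_drop_last s i j w a b :
    K (bracket w j ^+ 2) ->
    (forall b', K (bracket a i * chain i (rcons s j) * bracket j b'
                   * bracket i j)) ->
  K (bracket a i * chain i (rcons (rcons s w) j) * bracket j b * bracket i j).
Proof.
move=> Kwj Ks; rewrite 2!chain_rcons last_rcons.
have -> : bracket a i * (chain i s * bracket (last i s) w * bracket w j)
      * bracket j b * bracket i j =
    (- bracket w b)
      * (bracket a i * chain i (rcons s j) * bracket j w * bracket i j)
    + (- bracket a i * chain i s * bracket (last i s) b * bracket i j)
      * bracket w j ^+ 2.
  by rewrite chain_rcons /bracket; ring.
by apply: K_add; apply: K_mul.
Qed.

(** Induction on the number of inner points: a last inner point [w] linked to [j]
    is dropped. When it is linked to [i] instead, the ends [i] and [j] are first
    exchanged, which costs only a multiple of [bracket i j ^+ 2]. The brackets with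
    [a] and [b] are needed to feed the Pluecker relations. *)
Lemma chain_in_squares s i j a b :
    K (bracket i j ^+ 2) ->
    (forall w, w \in s -> K (bracket w i ^+ 2) \/ K (bracket w j ^+ 2)) ->
  K (bracket a i * chain i (rcons s j) * bracket j b * bracket i j).
Proof.
elim/last_ind: s i j a b => [|s w IHs] i j a b Kij Ks.
  rewrite /= mulr1.
  have -> : bracket a i * bracket i j * bracket j b * bracket i j =
    (bracket a i * bracket j b) * bracket i j ^+ 2 by ring.
  exact: K_mul.
have Ks' v : v \in s -> K (bracket v i ^+ 2) \/ K (bracket v j ^+ 2).
  by move=> sv; apply: Ks; rewrite mem_rcons inE sv orbT.
have [] := Ks w; first by rewrite mem_rcons mem_head.
- move=> Kwi; have [r E] := chain_swap_ends i j s w.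
  have -> : bracket a i * chain i (rcons (rcons s w) j) * bracket j b
      * bracket i j =
    (- 1) * (bracket b j * chain j (rcons (rcons s w) i) * bracket i a
             * bracket j i)
    + (bracket a i * bracket j b * r) * bracket i j ^+ 2.
    transitivity (bracket a i * bracket j b *
                  (bracket i j * chain i (rcons (rcons s w) j))).
      by ring.
    by rewrite E /bracket; ring.
  apply: K_add; apply: K_mul => //; apply: chain_drop_last => // b'.
  apply: IHs => [|v /Ks'[]]; [|by right|by left].
  by have -> : bracket j i ^+ 2 = bracket i j ^+ 2 by rewrite /bracket; ring.
- by move=> Kwj; apply: chain_drop_last => // b'; apply: IHs.
Qed.
End Chains.

(** * The trace map in characteristic 2 *)

Section Char2.
Variables (R : comNzRingType) (char2 : 2%N \in [pchar R]).

Lemma sqrD_char2 (a b : R) : (a + b) ^+ 2 = a ^+ 2 + b ^+ 2.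
Proof. by rewrite -!(pFrobenius_autE char2) rmorphD. Qed.

Lemma mulr2n_char2 (a : R) : a *+ 2 = 0.
Proof. by rewrite -mulr_natr (pcharf0 char2) mulr0. Qed.

Lemma subr_char2 (a b : R) : a - b = a + b.
Proof. by apply/eqP; rewrite subr_eq -addrA -mulr2n mulr2n_char2 addr0. Qed.

End Char2.

Section SquareRoot.
Variables (k : fieldType) (char2 : 2%N \in [pchar k]).

(** A projection of [k] onto its subfield of squares, followed by the square root:
    a splitting of the Frobenius map of the field [k]. *)
Definition is_root_projection (s : k -> k) :=
  [/\ forall a b, s (a + b) = s a + s b,
      forall c a, s (c ^+ 2 * a) = c * s a & s 1 = 1].

(** As [k] need not be finite over its squares, Zorn's lemma is used: a maximal
    additive subgroup [U] stable under multiplication by squares and avoiding [1] is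
    a complement of the field of squares. *)
Lemma root_projection_exists : exists s, is_root_projection s.
Proof.
pose P (U : k -> Prop) := (forall a b c d, U a -> U b ->
  U (c ^+ 2 * a + d ^+ 2 * b)) /\ ~ U 1.
(* The predicate tolerates the empty set, the union of the empty chain. *)
have [F FP chainF|U [[U_lin nU1] U_max]] := @classical_sets.Zorn_bigcup k P.
  split=> [a b c d [X FX Xa] [Y FY Yb]|[X FX X1]]; last by case: (FP X FX).
  have [XY|YX] := chainF X Y FX FY.
    by exists Y => //; apply: (FP Y FY).1 => //; apply: XY.
  by exists X => //; apply: (FP X FX).1 => //; apply: YX.
have U0 : U 0.
  apply: contrapT => nU0; apply: (U_max (fun a => U a \/ a = 0)).
    by split=> [a Ua|/(_ 0)/=]; [left | move/(_ (or_intror erefl))].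
  split=> [a b c d|]; last by case=> // /eqP; rewrite oner_eq0.
  move=> [Ua|->] [Ub|->]; rewrite ?mulr0 ?addr0 ?add0r.
  - by left; apply: U_lin.
  - left; have := U_lin a a c 0 Ua Ua; by rewrite expr0n mul0r addr0.
  - left; have := U_lin b b d 0 Ub Ub; by rewrite expr0n mul0r addr0.
  - by right.
have U_mul c a : U a -> U (c ^+ 2 * a).
  by move=> Ua; have := U_lin _ _ c 0 Ua U0; rewrite mulr0 addr0.
have U_add a b : U a -> U b -> U (a + b).
  by move=> Ua Ub; have := U_lin _ _ 1 1 Ua Ub; rewrite expr1n !mul1r.
have split_ex a : exists c : k, U (a - c ^+ 2).
  apply: contrapT => nex; apply: (U_max (fun b => exists c, U (b - c ^+ 2 * a))).
    split=> [b Ub|/(_ a)/=]; first by exists 0; rewrite expr0n mul0r subr0.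
    move=> sub; apply: nex; exists 0; rewrite expr0n subr0; apply: sub.
    by exists 1; rewrite expr1n mul1r subrr.
  split=> [x y c d [e Ue] [f Uf]|[c Uc]].
    exists (c * e + d * f); rewrite (sqrD_char2 char2).
    have -> : c ^+ 2 * x + d ^+ 2 * y - ((c * e) ^+ 2 + (d * f) ^+ 2) * a =
      c ^+ 2 * (x - e ^+ 2 * a) + d ^+ 2 * (y - f ^+ 2 * a) by ring.
    exact: U_lin.
  have [c0|c_neq0] := eqVneq c 0.
    by apply: nU1; rewrite c0 expr0n mul0r subr0 in Uc.
  apply: nex; exists (c^-1).
  have := U_mul c^-1 _ Uc; rewrite (subr_char2 char2) (subr_char2 char2).
  by rewrite mulrDr mulr1 mulrA -exprMn mulVf // expr1n mul1r addrC.
pose s a := sval (cid (split_ex a)).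
have sP a : U (a - s a ^+ 2).
  by rewrite /s; case: (cid _).
have s_eq a c : U (a - c ^+ 2) -> s a = c.
  move=> Uac; apply: contrapT => /eqP ne; apply: nU1.
  have := U_mul (s a - c)^-1 _ (U_add _ _ (sP a) Uac).
  have -> : a - s a ^+ 2 + (a - c ^+ 2) = (s a - c) ^+ 2.
    rewrite !(subr_char2 char2) (sqrD_char2 char2) addrACA -mulr2n.
    by rewrite (mulr2n_char2 char2) add0r.
  by rewrite -exprMn mulVf ?expr1n // subr_eq0.
exists s; split=> [a b|c a|].
- apply: s_eq; rewrite (sqrD_char2 char2) opprD addrACA; exact: U_add.
- apply: s_eq; rewrite exprMn -mulrBr; exact: U_mul.
- by apply: s_eq; rewrite expr1n subrr.
Qed.

End SquareRoot.

Section Trace.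
Variables (k : fieldType) (char2 : 2%N \in [pchar k]) (N : nat).
Variables (s : k -> k) (s_proj : is_root_projection s).
Local Notation R := {mpoly k[N]}.
Implicit Types (f g : R) (m : 'X_{1..N}).

Lemma mcoeffMXE f m m' :
  (f * 'X_[m])@_m' = if (m <= m')%MM then f@_(m' - m) else 0.
Proof.
case: ifP => [le_m|nle_m]; first by rewrite -{1}(submK le_m) addmC mcoeffMX.
rewrite mcoeffM big1 // => -[k1 k2] /eqP/= E; rewrite mcoeffX.
case: eqP => [Em|_]; last by rewrite mulr0.
case/negP: (negbT nle_m); apply/mnm_lepP => i.
by rewrite Em [X in (_ <= fun_of_multinom X i)%N]E mnmDE leq_addl.
Qed.

Definition all_odd m : 'X_{1..N} := [multinom (m i).*2.+1 | i < N].

(** A left inverse of Frobenius up to a factor: [f ^+ 2] times the product of the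
    variables goes to [f], and a monomial with an even exponent to [0]. Over a
    perfect field it generates all the maps inverse-linear for Frobenius. *)
Definition trace f : R :=
  \sum_(m : 'X_{1..N < msize f}) s f@_(all_odd m) *: 'X_[m].

Lemma root_projection0 : s 0 = 0.
Proof.
have [_ sM _] := s_proj.
by rewrite -[in LHS](mul0r 0) -[X in X * _](expr0n _ 2) sM mul0r.
Qed.

Lemma mdeg_all_odd m : (mdeg m <= mdeg (all_odd m))%N.
Proof.
by rewrite !mdegE; apply: leq_sum => i _; rewrite mnmE -addnn -addnS leq_addr.
Qed.

Lemma mcoeff_trace f m : (trace f)@_m = s f@_(all_odd m).
Proof.
have [lt_m|ge_m] := ltnP (mdeg m) (msize f).
  by rewrite (mcoeff_mpoly (fun m => s f@_(all_odd m))).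
rewrite [f@__]memN_msupp_eq0 ?root_projection0; last first.
  apply/negP => /msize_mdeg_lt lt_f; have := leq_ltn_trans (mdeg_all_odd m) lt_f.
  by rewrite ltnNge ge_m.
rewrite /trace raddf_sum /= big1 // => m' _; rewrite mcoeffZ mcoeffX.
case: eqP => [E|_]; last by rewrite mulr0.
by have := bmdeg m'; rewrite E ltnNge ge_m.
Qed.

Lemma traceD f g : trace (f + g) = trace f + trace g.
Proof.
have [sD _ _] := s_proj; apply/mpolyP=> m.
by rewrite mcoeffD !mcoeff_trace mcoeffD sD.
Qed.

Lemma trace0 : trace 0 = 0.
Proof. by apply/mpolyP=> m; rewrite mcoeff_trace !mcoeff0 root_projection0. Qed.

Lemma pchar_mpoly : 2%N \in [pchar R].
Proof. exact: (rmorph_pchar (@mpolyC N k)). Qed.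

Lemma traceN f : trace (- f) = - trace f.
Proof.
by apply/eqP; rewrite -addr_eq0 -traceD addNr trace0.
Qed.

Lemma trace_sqrM f g : trace (f ^+ 2 * g) = f * trace g.
Proof.
have [sD sM s1] := s_proj.
elim/mpolyind: f => [|c m f _ _ IHf]; first by rewrite expr0n !mul0r trace0.
rewrite (sqrD_char2 pchar_mpoly) !mulrDl traceD IHf; congr (_ + _).
apply/mpolyP=> m'; rewrite mcoeff_trace exprZn -!scalerAl !mcoeffZ sM.
congr (_ * _); rewrite mpolyXn !(mulrC 'X_[_]) !mcoeffMXE.
have -> : (m *+ 2 <= all_odd m')%MM = (m <= m')%MM.
  apply/mnm_lepP/mnm_lepP=> le i; have := le i; rewrite mulmnE mnmE; lia.
case: ifP => [/mnm_lepP le|_]; last by rewrite root_projection0.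
rewrite mcoeff_trace; congr (s (mcoeff _ g)).
by apply/mnmP=> i; have := le i; rewrite !(mulmnE, mnmBE, mnmE); lia.
Qed.

(** In characteristic 2 the derivative in [i] vanishes exactly when only even
    powers of ['X_i] occur. *)
Lemma trace_mderiv0 i f : f^`M(i) = 0 -> trace f = 0.
Proof.
move=> df; apply/mpolyP=> m; rewrite mcoeff_trace mcoeff0.
have := congr1 (mcoeff (all_odd m - U_(i))%MM) df.
rewrite mcoeff_mderiv mcoeff0 submK; last first.
  by apply/mnm_lepP=> j; rewrite mnm1E mnmE; case: eqP.
rewrite mnmBE mnm1E eqxx mnmE subn1 /= -mul2n mulrSr mulrnA mulr2n_char2 //.
by rewrite mul0rn add0r => ->; rewrite root_projection0.
Qed.

Lemma trace_prod_vars : trace (\prod_i 'X_i) = 1.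
Proof.
have [_ _ s1] := s_proj.
apply/mpolyP=> m; rewrite mcoeff_trace mprodXE mcoeffX mcoeff1.
have -> : ((\sum_i U_(i))%MM == all_odd m) = (m == 0%MM).
  apply/eqP/eqP=> [/mnmP E|->]; apply/mnmP=> i; last first.
    rewrite mnmE mnm0E mnm_sumE (bigD1 i) //= mnm1E eqxx big1 // => j /negPf ne.
    by rewrite mnm1E ne.
  have := E i; rewrite mnmE mnm_sumE (bigD1 i) //= mnm1E eqxx.
  rewrite big1 => [|j /negPf ne].
    by case=> /esym/eqP; rewrite double_eq0 mnm0E => /eqP.
  by rewrite mnm1E ne.
by case: eqP => _; rewrite ?root_projection0 ?s1.
Qed.

End Trace.

(** * The trace of a chain of vertices *)

Section ChainTrace.
Variables (k : fieldType) (char2 : 2%N \in [pchar k]) (n : nat).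
Variables (s : k -> k) (s_proj : is_root_projection s).
Local Notation R := {mpoly k[n + n]}.
Local Notation x := (@xvar k n).
Local Notation y := (@yvar k n).
Local Notation trace := (trace s).
Implicit Types (v w : 'I_n) (t : seq 'I_n) (a : R * R).

Definition vertex_point v : R * R := (x v, y v).

(** For [a = (1, 0)] and [t] the list [v1, ..., vm], this is the polynomial
    [y_v1 * f_(v1,v2) * ... * f_(v(m-1),vm) * x_vm]: the extra points [(1, 0)] and
    [(0, 1)] turn the two end variables into brackets. *)
Definition vertex_chain a t : R :=
  chain a (rcons (map vertex_point t) (0, 1)).

Lemma vertex_chainE a t :
  vertex_chain a t = a.1 * vertex_chain (1, 0) t + a.2 * vertex_chain (0, 1) t.
Proof. by case: t => [|v t]; rewrite /vertex_chain /= /bracket /=; ring. Qed.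

Lemma mderiv_x v w : (x v)^`M(lshift n w) = (v == w)%:R.
Proof.
rewrite /xvar mderivX mnm1E eq_lshift; case: eqP => [->|_]; last by rewrite scale0r.
by rewrite -[X in (X - _)%MM]add0m addmK mpolyX0 scale1r.
Qed.

Lemma mderiv_y v w : (y v)^`M(lshift n w) = 0.
Proof. by rewrite /yvar mderivX mnm1E eq_rlshift scale0r. Qed.

Lemma mderiv_vertex_chain v a t : v \notin t ->
    a.1^`M(lshift n v) = 0 -> a.2^`M(lshift n v) = 0 ->
  (vertex_chain a t)^`M(lshift n v) = 0.
Proof.
elim: t a => [|w t IHt] a v_t a1 a2.
  rewrite /vertex_chain /= /bracket /= mulr1 mulr1 mul0r subr0.
  exact: a1.
move: v_t; rewrite inE negb_or => /andP[/negPf v_w v_t].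
have dxw : (x w)^`M(lshift n v) = 0 by rewrite mderiv_x eq_sym v_w.
rewrite /vertex_chain /= -/(vertex_chain _ _) mderivM IHt ?mderiv_y //.
rewrite /bracket /= mderivB !mderivM a1 a2 dxw mderiv_y.
by rewrite !(mulr0, mul0r, addr0, subr0).
Qed.

(** Expanding the chain at its first vertex [v], the summand that contributes is
    [x v * y v] times the chain of the tail; the other one is [y v ^+ 2] times a
    polynomial in which [x v] does not occur. The product over the vertices outside
    [t] allows the induction to stay in the ring in all the variables. *)
Lemma trace_vertex_chain_compl t : uniq t ->
  trace ((\prod_(w | w \notin t) (x w * y w)) * vertex_chain (1, 0) t) = 1.
Proof.
elim: t => [_|v t IHt /= /andP[v_t uniq_t]].
  rewrite /vertex_chain /= /bracket /= !mulr1 mul0r subr0 mulr1.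
  rewrite big_split /= -[RHS](trace_prod_vars (n + n) s_proj) big_split_ord /=.
  by congr (trace (_ * _)); apply: eq_bigl.
rewrite -[RHS](IHt uniq_t) (bigD1 v v_t) /=.
have -> : \prod_(w | (w \notin t) && (w != v)) (x w * y w) =
    \prod_(w | w \notin v :: t) (x w * y w).
  by apply: eq_bigl => w; rewrite inE negb_or andbC.
set p := \prod_(w | _) _.
have -> : vertex_chain (1, 0) (v :: t) =
    y v * (x v * vertex_chain (1, 0) t + y v * vertex_chain (0, 1) t).
  rewrite -[in RHS](vertex_chainE (vertex_point v)).
  by rewrite /vertex_chain /= /bracket /=; ring.
have -> : p * (y v * (x v * vertex_chain (1, 0) t
                      + y v * vertex_chain (0, 1) t)) =
   x v * y v * p * vertex_chain (1, 0) t
   + y v ^+ 2 * (p * vertex_chain (0, 1) t).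
  by ring.
rewrite (traceD s_proj) (trace_sqrM char2 s_proj).
rewrite [X in _ + _ * X](@trace_mderiv0 _ char2 _ _ s_proj (lshift n v)).
  by rewrite mulr0 addr0.
rewrite mderivM mderiv_vertex_chain ?mderiv0 // ?mulr0 ?addr0; last first.
  by rewrite -mpolyC1 mderivC.
rewrite (_ : p^`M(_) = 0) ?mul0r // /p.
elim/big_ind: _ => [|f g df dg|w]; first by rewrite -mpolyC1 mderivC.
  by rewrite mderivM df dg mul0r mulr0 addr0.
rewrite inE negb_or eq_sym => /andP[/negPf w_v _].
by rewrite mderivM mderiv_x mderiv_y eq_sym w_v mul0r mulr0 addr0.
Qed.

Lemma trace_vertex_chain t : uniq t -> (forall v, v \in t) ->
  trace (vertex_chain (1, 0) t) = 1.
Proof.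
move=> uniq_t t_all; rewrite -[RHS](trace_vertex_chain_compl uniq_t).
by rewrite big1 ?mul1r // => v; rewrite t_all.
Qed.

End ChainTrace.

(** * The chain of a weakly closed labeling *)

Section Ideal.
Variables (k : fieldType) (n : nat) (G : simple_graph n).
Local Notation R := {mpoly k[n + n]}.
Local Notation J := (@binomial_edge_ideal k n G).

Lemma edge_binomial_in i j : edge G i j -> edge_binomial k i j \in J.
Proof.
move=> Gij; apply/asboolP; exists (fun a b => ((a == i) && (b == j))%:R).
rewrite (bigD1 i) //= (bigD1 j) //= !eqxx mul1r !big1 ?addr0 //.
- by move=> a /negPf ai; rewrite big1 // => b _; rewrite ai mul0r.
- by move=> b /andP[_ /negPf bj]; rewrite bj andbF mul0r.
Qed.

Lemma binomial_edge_ideal_ind (P : R -> Prop) :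
    P 0 -> (forall f g, P f -> P g -> P (f + g)) ->
    (forall i j c, edge G i j -> P (c * edge_binomial k i j)) ->
  forall f, f \in J -> P f.
Proof.
move=> P0 PD Pe f /asboolP[c ->].
by elim/big_ind: _ => // i _; elim/big_ind: _ => // j Gij; apply: Pe.
Qed.

End Ideal.

Section Compatible.
Variables (k : fieldType) (char2 : 2%N \in [pchar k]) (n : nat).
Variables (G : simple_graph n).
Variables (s : k -> k) (s_proj : is_root_projection s).
Local Notation R := {mpoly k[n + n]}.
Local Notation J := (@binomial_edge_ideal k n G).
Local Notation trace := (trace s).
Local Notation point := (@vertex_point k n).

(** An ideal that contains the squares of the edge binomials, and can hence
    replace the Frobenius power of the binomial edge ideal. *)
Definition trace_into_ideal (q : R) := forall r : R, trace (r * q) \in J.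

Lemma trace_into_idealD f g :
  trace_into_ideal f -> trace_into_ideal g -> trace_into_ideal (f + g).
Proof. by move=> Kf Kg r; rewrite mulrDr (traceD s_proj) rpredD. Qed.

Lemma trace_into_idealM f g : trace_into_ideal f -> trace_into_ideal (g * f).
Proof. by move=> Kf r; rewrite mulrA. Qed.

Lemma trace_into_ideal_sqr i j :
  edge G i j -> trace_into_ideal (bracket (point i) (point j) ^+ 2).
Proof.
move=> Gij r; rewrite mulrC (trace_sqrM char2 s_proj) mulrC.
by apply: idealMr; apply: edge_binomial_in.
Qed.

Lemma vertex_chain_in_squares p i t j q :
    edge G i j -> (forall w, w \in t -> edge G i w \/ edge G w j) ->
  trace_into_ideal
    (vertex_chain ((1, 0) : R * R) (p ++ i :: t ++ j :: q) * edge_binomial k i j).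
Proof.
move=> Gij Gt.
have [b [l E]] : exists b l, rcons (map point q) (0, 1) = b :: l.
  by rewrite headI; do 2!eexists.
rewrite /vertex_chain map_cat /= map_cat /= rcons_cat /= rcons_cat /= E.
rewrite chain_cat /= chain_cat /=.
set a := last _ _; set z := last _ _.
set c0 := chain (1, 0) _; set ci := chain (point i) _.
set f := edge_binomial k i j.
have -> : c0 * (bracket a (point i) * (ci * (bracket z (point j)
      * (bracket (point j) b * chain b l)))) * f =
    (c0 * chain b l) *
    (bracket a (point i) * chain (point i) (rcons (map point t) (point j))
     * bracket (point j) b * bracket (point i) (point j)).
  by rewrite chain_rcons -/z -/ci /f /bracket /edge_binomial /=; ring.
apply: trace_into_idealM.
apply: (chain_in_squares trace_into_idealD trace_into_idealM).
  exact: trace_into_ideal_sqr.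
move=> _ /mapP[w /Gt[] Gw ->]; [left|right]; apply: trace_into_ideal_sqr => //.
by rewrite edge_sym.
Qed.

(** With the vertices listed in the order of the labels, the vertices between the
    ends of an edge are adjacent to one of them, as [vertex_chain_in_squares]
    requires. *)
Lemma weakly_closed_trace : weakly_closed G ->
  exists u : R, trace u = 1 /\ forall f, f \in J -> trace (u * f) \in J.
Proof.
case=> label [g labelK gK] G_closed.
pose vs := map g (enum 'I_n).
have uniq_vs : uniq vs by rewrite map_inj_uniq ?enum_uniq //; exact: can_inj gK.
have vs_all v : v \in vs.
  by apply/mapP; exists (label v); rewrite ?mem_enum ?labelK.
have vs_sorted : pairwise (fun v w => (label v < label w)%N) vs.
  rewrite pairwise_map.
  have -> : pairwise (relpre g (fun v w => (label v < label w)%N)) (enum 'I_n) =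
            pairwise ltn (map val (enum 'I_n)).
    by rewrite pairwise_map; apply: eq_pairwise => v w /=; rewrite !gK.
  by rewrite val_enum_ord -sorted_pairwise ?iota_ltn_sorted //; exact: ltn_trans.
exists (vertex_chain ((1, 0) : R * R) vs); split.
  exact: (trace_vertex_chain char2 s_proj).
apply: binomial_edge_ideal_ind => [|f h Jf Jh|i j c Gij].
- by rewrite mulr0 (trace0 _ s_proj) rpred0.
- by rewrite mulrDr (traceD s_proj) rpredD.
wlog lt_ij : i j c Gij / (label i < label j)%N => [hwlog|].
  have [lt_ij|lt_ji|/ord_inj E] := ltngtP (label i) (label j); first exact: hwlog.
  - have -> : c * edge_binomial k i j = (- c) * edge_binomial k j i.
      by rewrite /edge_binomial; ring.
    by apply: hwlog => //; rewrite edge_sym.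
  - by rewrite (can_inj labelK E) edge_irrefl in Gij.
have vs_i := vs_all i; have vs_j := vs_all j.
clearbody vs; case/splitPr: vs / vs_i vs_j {uniq_vs vs_all} vs_sorted => p t.
rewrite mem_cat inE pairwise_cat => /or3P[p_j|/eqP E|t_j] /and3P[p_lt _ t_lt].
- have /allrelP/(_ j i p_j (mem_head _ _)) := p_lt.
  by rewrite ltnNge ltnW.
- by rewrite E ltnn in lt_ij.
case/splitPr: t / t_j t_lt {p_lt} => [t q].
rewrite /= all_cat pairwise_cat => /and3P[/andP[/allP i_lt _] /allrelP t_lt_j _].
rewrite mulrCA; apply: vertex_chain_in_squares => // w t_w.
apply: G_closed Gij _ _; first exact: i_lt.
exact: t_lt_j (mem_head _ _).
Qed.

End Compatible.

(** * Tensor products, Frobenius splittings and purity *)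

Section TensorRules.
Variables (A : comNzRingType) (M N : lmodType A).
Implicit Types (m : M) (x : N).

Lemma tensor_pureE (u v : {freeg (M * N)%type / int}) :
  tensor_relation (u - v) <-> \pi_(tensor M N) u = \pi_(tensor M N) v.
Proof.
split=> [uv|/eqP]; first by apply/eqP; rewrite -Quotient.idealrBE; apply/asboolP.
by rewrite -Quotient.idealrBE => /asboolP.
Qed.

Lemma tensor_pureDl m1 m2 x :
  tensor_pure (m1 + m2) x = tensor_pure m1 x + tensor_pure m2 x.
Proof.
rewrite /tensor_pure -raddfD; apply/tensor_pureE; rewrite opprD addrA.
exact: tensor_relDl.
Qed.

Lemma tensor_pureZ a m x : tensor_pure (a *: m) x = tensor_pure m (a *: x).
Proof. by apply/tensor_pureE; apply: tensor_relZ. Qed.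

Variables (r : N -> A).
Hypotheses (rD : forall x y, r (x + y) = r x + r y)
           (rZ : forall a x, r (a *: x) = a * r x).

(** The map [m] tensor [x |-> r x *: m] is well defined on the tensor product. *)
Lemma tensor_eval m m' x x' :
  tensor_pure m x = tensor_pure m' x' -> r x *: m = r x' *: m'.
Proof.
pose ev (mx : M * N) : zmodule M := r mx.2 *: mx.1.
move/tensor_pureE => rel; apply/eqP; rewrite -subr_eq0; apply/eqP.
have evB : {morph fglift ev : u v / u - v} := lift_is_additive ev.
have ev0 u : tensor_relation u -> fglift ev u = 0 :> zmodule M.
  elim=> {u rel} [|u v _ Eu _ Ev|m1 m2 y|m1 y1 y2|a m1 y].
  - by rewrite -[X in fglift _ X](subrr 0) evB subrr.
  - by rewrite evB Eu Ev subrr.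
  - rewrite !evB !liftU !scale1r /ev /= scalerDr.
    by rewrite addrAC addrK subrr.
  - rewrite !evB !liftU !scale1r /ev /= rD scalerDl.
    by rewrite addrAC addrK subrr.
  - by rewrite !evB !liftU !scale1r /ev /= rZ scalerA mulrC subrr.
by rewrite -[RHS](ev0 _ rel) evB !liftU !scale1r.
Qed.

End TensorRules.

Lemma retract_pure (A : comNzRingType) (N : lmodType A) (phi : {linear A^o -> N})
    (r : N -> A) :
    (forall x y, r (x + y) = r x + r y) -> (forall a x, r (a *: x) = a * r x) ->
    r (phi 1) = 1 ->
  pure_map phi.
Proof.
move=> rD rZ r1 M m m' /(tensor_eval rD rZ).
by rewrite r1 !scale1r.
Qed.

Lemma F_split_F_pure (A : comNzRingType) (p : nat) (charAp : p \in [pchar A])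
    (r : A -> A) :
    (forall x y, r (x + y) = r x + r y) ->
    (forall a x, r (a ^+ p * x) = a * r x) -> r 1 = 1 ->
  F_pure charAp.
Proof.
move=> rD rM r1.
apply: (@retract_pure _ _ _ (r : frobenius_pushforward charAp -> A)) => //.
exact: etrans (congr1 r (expr1n A p)) r1.
Qed.

Section WeaklyClosed.
Variables (k : fieldType) (char2 : 2%N \in [pchar k]) (n : nat).
Variables (G : simple_graph n).
Local Notation R := {mpoly k[n + n]}.
Local Notation J := (@binomial_edge_ideal k n G).
Local Notation A := (@binomial_edge_ring k n G).

Lemma weakly_closed_F_pure :
  weakly_closed G -> F_pure (binomial_edge_ring_pchar G char2).
Proof.
move=> G_closed; have [s s_proj] := root_projection_exists char2.
have [u [tr_u tr_J]] := weakly_closed_trace char2 s_proj G_closed.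
pose r (a : A) : A := \pi_{ideal_quot J} (trace s (u * repr a)).
have r_pi (f : R) : r (\pi_{ideal_quot J} f) = \pi_{ideal_quot J} (trace s (u * f)).
  apply/eqP; rewrite -Quotient.idealrBE -(traceN s_proj).
  rewrite -(traceD s_proj) -mulrBr; apply: tr_J.
  by rewrite Quotient.idealrBE reprK.
apply: (@F_split_F_pure _ _ _ r) => [a b|a b|].
- rewrite -[a]reprK -[b]reprK.
  rewrite -[X in r X](rmorphD (\pi_{ideal_quot J})) !r_pi.
  by rewrite mulrDr (traceD s_proj) rmorphD.
- rewrite -[a]reprK -[b]reprK; set f := repr a; set g := repr b.
  rewrite -[X in X * _](rmorphXn (\pi_{ideal_quot J})).
  rewrite -[X in r X](rmorphM (\pi_{ideal_quot J})).
  by rewrite !r_pi mulrCA (trace_sqrM char2 s_proj) rmorphM.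
- rewrite -[X in r X](rmorph1 (\pi_{ideal_quot J})).
  by rewrite r_pi mulr1 tr_u rmorph1.
Qed.

End WeaklyClosed.

(** * Functionals on the quotient ring *)

Section Coinduced.
Variables (A : comNzRingType) (V : zmodType).

(** With [V] the base field and [A] the quotient ring, this module plays the role
    that the injective hull of the residue field has in Fedder's criterion. *)
Record coinduced := Coinduced {
  coinduced_fun :> A -> V;
  coinducedD : forall a b, coinduced_fun (a + b) = coinduced_fun a + coinduced_fun b
}.

Lemma coinducedP (m m' : coinduced) : (forall a, m a = m' a) -> m = m'.
Proof.
case: m m' => [f fD] [g gD] /= /funext E; subst g.
congr Coinduced; exact: Prop_irrelevance.
Qed.

HB.instance Definition _ := gen_eqMixin coinduced.
HB.instance Definition _ := gen_choiceMixin coinduced.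

Program Definition coinduced0 := @Coinduced (fun=> 0) _.
Next Obligation. by rewrite addr0. Qed.

Program Definition coinduced_opp (m : coinduced) := @Coinduced (fun a => - m a) _.
Next Obligation. by rewrite coinducedD opprD. Qed.

Program Definition coinduced_add (m m' : coinduced) :=
  @Coinduced (fun a => m a + m' a) _.
Next Obligation. by rewrite !coinducedD addrACA. Qed.

Fact coinduced_addA : associative coinduced_add.
Proof. by move=> m1 m2 m3; apply: coinducedP => a; exact: addrA. Qed.
Fact coinduced_addC : commutative coinduced_add.
Proof. by move=> m1 m2; apply: coinducedP => a; exact: addrC. Qed.
Fact coinduced_add0 : left_id coinduced0 coinduced_add.
Proof. by move=> m; apply: coinducedP => a; exact: add0r. Qed.
Fact coinduced_addN : left_inverse coinduced0 coinduced_opp coinduced_add.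
Proof. by move=> m; apply: coinducedP => a; exact: addNr. Qed.

HB.instance Definition _ := GRing.isZmodule.Build coinduced
  coinduced_addA coinduced_addC coinduced_add0 coinduced_addN.

Program Definition coinduced_scale (a : A) (m : coinduced) :=
  @Coinduced (fun b => m (a * b)) _.
Next Obligation. by rewrite mulrDr coinducedD. Qed.

Fact coinduced_scaleA a b m :
  coinduced_scale a (coinduced_scale b m) = coinduced_scale (a * b) m.
Proof. by apply: coinducedP => c /=; rewrite mulrCA mulrA. Qed.
Fact coinduced_scale1 : left_id 1 coinduced_scale.
Proof. by move=> m; apply: coinducedP => a /=; rewrite mul1r. Qed.
Fact coinduced_scaleDr : right_distributive coinduced_scale +%R.
Proof. by move=> a m m'; apply: coinducedP. Qed.
Fact coinduced_scaleDl m : {morph coinduced_scale^~ m : a b / a + b}.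
Proof. by move=> a b; apply: coinducedP => c /=; rewrite mulrDl coinducedD. Qed.

HB.instance Definition _ := GRing.Zmodule_isLmodule.Build A coinduced
  coinduced_scaleA coinduced_scale1 coinduced_scaleDr coinduced_scaleDl.

End Coinduced.

Section Functionals.
Variables (k : fieldType) (n : nat) (G : simple_graph n).
Local Notation R := {mpoly k[n + n]}.
Local Notation J := (@binomial_edge_ideal k n G).
Local Notation A := (@binomial_edge_ring k n G).
Local Notation M := (coinduced A k).
Local Notation pi := (\pi_{ideal_quot J}).
Implicit Types (S : {set 'I_(n + n)}) (f : R) (b : bool) (i j u v w : 'I_n).

Definition set_mnm S : 'X_{1..n + n} := [multinom (i \in S : nat) | i < n + n].

Definition sqfree_coeff S f : k := f@_(set_mnm S).

Lemma sqfree_coeffX S z f :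
  sqfree_coeff S ('X_z * f) = if z \in S then sqfree_coeff (S :\ z) f else 0.
Proof.
rewrite /sqfree_coeff mulrC mcoeffMXE.
have -> : (U_(z) <= set_mnm S)%MM = (z \in S).
  apply/mnm_lepP/idP => [/(_ z)|zS t].
    by rewrite mnm1E mnmE eqxx; case: (z \in S).
  by rewrite mnm1E mnmE; case: eqP => // <-; rewrite zS.
case: ifP => // zS; congr (mcoeff _ f); apply/mnmP=> t.
by rewrite mnmBE !mnmE in_setD1 eq_sym; case: eqP => [->|_]; rewrite ?zS ?subn0.
Qed.

(** [x v] or [y v]: the two rows of variables play symmetric roles. *)
Definition var b v : 'I_(n + n) := if b then lshift n v else rshift n v.
#[global] Arguments var : simpl never.

Lemma eq_var b b' v w : (var b v == var b' w) = (b == b') && (v == w).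
Proof.
by case: b b' => [] []; rewrite /var ?eq_lshift ?eq_rshift ?eq_lrshift ?eq_rlshift.
Qed.

(** The additive functionals of the polynomial ring that factor through [R_G]. *)
Definition descends (l : R -> k) :=
  (forall f g, l (f + g) = l f + l g) /\
  (forall i j f, edge G i j -> l (edge_binomial k i j * f) = 0).

Lemma descends_ideal l f : descends l -> f \in J -> l f = 0.
Proof.
case=> lD lJ.
apply: (@binomial_edge_ideal_ind k n G (fun f => l f = 0)) =>
  [|{}f g lf lg|i j c Gij].
- by apply: (addIr (l 0)); rewrite -lD !add0r.
- by rewrite lD lf lg addr0.
- by rewrite mulrC lJ.
Qed.

Lemma descend_ex l : descends l -> exists m : M, forall f, m (pi f) = l f.
Proof.
move=> l_desc; have [lD _] := l_desc.
have l_repr f : l (repr (pi f)) = l f.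
  rewrite -[in LHS](subrK f (repr _)) lD (descends_ideal l_desc) ?add0r //.
  by rewrite Quotient.idealrBE reprK.
have D (a a' : A) : l (repr (a + a')) = l (repr a) + l (repr a').
  by rewrite -[a]reprK -[a']reprK -[X in repr X](rmorphD pi) !l_repr lD.
by exists (@Coinduced A k (fun a => l (repr a)) D).
Qed.

Lemma coinduced_pi_inj (m m' : M) : (forall f, m (pi f) = m' (pi f)) -> m = m'.
Proof. by move=> E; apply: coinducedP => a; rewrite -[a]reprK. Qed.

Lemma coinduced_scale_pi f g (m : M) : (pi f *: m) (pi g) = m (pi (f * g)).
Proof. by rewrite [in RHS](rmorphM pi). Qed.

Lemma sqfree_coeffD S f g :
  sqfree_coeff S (f + g) = sqfree_coeff S f + sqfree_coeff S g.
Proof. exact: mcoeffD. Qed.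

Lemma sqfree_coeff_edge b S i j f :
  sqfree_coeff S (edge_binomial k i j * f) = (-1) ^+ (~~ b) *
    ((if (var b i \in S) && (var (~~ b) j \in S)
      then sqfree_coeff (S :\ var b i :\ var (~~ b) j) f else 0)
    - (if (var b j \in S) && (var (~~ b) i \in S)
       then sqfree_coeff (S :\ var b j :\ var (~~ b) i) f else 0)).
Proof.
have -> : edge_binomial k i j * f = (-1) ^+ (~~ b) *
    ('X_(var b i) * ('X_(var (~~ b) j) * f)
     - 'X_(var b j) * ('X_(var (~~ b) i) * f)).
  by rewrite /edge_binomial /xvar /yvar; case: b => /=; ring.
rewrite mulr_sign /sqfree_coeff; case: b; rewrite /= ?mcoeffN mcoeffB;
rewrite -!/(sqfree_coeff _ _) !sqfree_coeffX !in_setD1 !eq_var;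
rewrite ?expr0 ?expr1 ?mul1r ?mulN1r /=;
by do 4![case: (_ \in S)].
Qed.

Definition pair_coeff b u w := sqfree_coeff [set var b u; var (~~ b) w].

(** The two monomials are those that [f_(v,w)] identifies when [vw] is an edge;
    they are identified with no other monomial if [u] is adjacent to neither [v]
    nor [w]. *)
Definition fork_coeff b u v w f :=
  sqfree_coeff [set var b u; var b v; var (~~ b) w] f
  + sqfree_coeff [set var b u; var b w; var (~~ b) v] f.

(** These are all the monomials with two [x] and one [y] at [u], [v], [w], so that
    swapping the letters of two vertices permutes them. *)
Definition path_coeff u v w f :=
  sqfree_coeff [set var true u; var true v; var false w] f
  + sqfree_coeff [set var true u; var true w; var false v] f
  + sqfree_coeff [set var true v; var true w; var false u] f.

Lemma descends_unit : descends (sqfree_coeff set0).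
Proof.
split=> [|i j f _]; first exact: sqfree_coeffD.
by rewrite (sqfree_coeff_edge true) !inE subrr mulr0.
Qed.

Lemma descends_pair b u w : ~~ edge G u w -> descends (pair_coeff b u w).
Proof.
move=> nG; split=> [|i j f Gij]; first exact: sqfree_coeffD.
rewrite /pair_coeff (sqfree_coeff_edge b) !inE !eq_var !eqxx /=.
have -> : (b == ~~ b) = false by case: b.
have -> : (~~ b == b) = false by case: b.
rewrite /= !orbF.
have nij u' v' : edge G u' v' -> (u' == u) && (v' == w) = false.
  by move=> Guv; apply: contraNF nG => /andP[/eqP <- /eqP <-].
by rewrite !nij ?subrr ?mulr0 // edge_sym.
Qed.

Lemma set3_remove2 (T : finType) (a b c : T) : a != b -> a != c -> b != c ->
  [set a; b; c] :\ b :\ c = [set a].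
Proof.
move=> ab ac bc; apply/setP=> z; rewrite !inE.
by case: (eqVneq z a) => [->|_]; [rewrite ab ac | case: (z == b); case: (z == c)].
Qed.

Lemma var_signs b : (b == ~~ b) = false /\ (~~ b == b) = false.
Proof. by case: b. Qed.

Lemma descends_fork b u v w : u != v -> u != w -> v != w ->
  ~~ edge G u v -> ~~ edge G u w -> descends (fork_coeff b u v w).
Proof.
move=> /negPf uv /negPf uw /negPf vw nGuv nGuw.
have [b1 b2] := var_signs b.
split=> [f g|i j f Gij]; first by rewrite /fork_coeff !sqfree_coeffD addrACA.
rewrite /fork_coeff !(sqfree_coeff_edge b) -mulrDr.
have ij : i != j by apply: contraTneq Gij => ->; rewrite edge_irrefl.
have nu i' j' : edge G i' j' -> i' = u ->
    [/\ (j' == u) = false, (j' == v) = false & (j' == w) = false].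
  move=> + E; rewrite E => Gu.
  by split; apply: contraTF Gu => /eqP ->; rewrite ?edge_irrefl.
have E1 : [set var b u; var b v; var (~~ b) w] :\ var b v :\ var (~~ b) w =
    [set var b u].
  by apply: set3_remove2; rewrite !eq_var ?eqxx ?b1 ?b2 ?uv ?uw.
have E2 : [set var b u; var b w; var (~~ b) v] :\ var b w :\ var (~~ b) v =
    [set var b u].
  by apply: set3_remove2; rewrite !eq_var ?eqxx ?b1 ?b2 ?uv ?uw.
rewrite !inE !eq_var !eqxx b1 b2 /= !orbF.
have Gji : edge G j i by rewrite edge_sym.
have [iu|iu] := eqVneq i u.
  have [-> -> ->] := nu i j Gij iu; rewrite iu uv uw /=.
  by rewrite !subrr addr0 mulr0.
have [ju|ju] := eqVneq j u.
  have [_ -> ->] := nu j i Gji ju; rewrite /= ?andbF.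
  by rewrite !subrr addr0 mulr0.
rewrite /=.
have [iv|iv] := eqVneq i v.
  rewrite iv vw /=; have [jw|jw] := eqVneq j w.
    rewrite jw (eq_sym w v) vw /= E1 E2.
    by rewrite subr0 sub0r subrr mulr0.
  by rewrite !andbF /= !subrr addr0 mulr0.
have [iw|iw] := eqVneq i w.
  have [jv|jv] := eqVneq j v.
    rewrite iw jv vw /= E1 E2.
    by rewrite subr0 sub0r addNr mulr0.
  by rewrite !andbF /= !subrr addr0 mulr0.
by rewrite !andbF /= !subrr addr0 mulr0.
Qed.

Lemma descends_path u v w : u != v -> u != w -> v != w ->
  descends (path_coeff u v w).
Proof.
move=> uv uw vw; have [vu [wu wv]] : v != u /\ w != u /\ w != v.
  by rewrite ![_ == u]eq_sym [w == v]eq_sym.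
split=> [f g|i j f Gij]; first by rewrite /path_coeff !sqfree_coeffD; ring.
rewrite /path_coeff !(sqfree_coeff_edge true) /= !mul1r.
have ij : i != j by apply: contraTneq Gij => ->; rewrite edge_irrefl.
have D (x y z : 'I_n) : x != y -> x != z -> y != z ->
    [set var true x; var true y; var false z] :\ var true y :\ var false z =
    [set var true x].
  by move=> *; apply: set3_remove2; rewrite !eq_var ?eqxx // negb_and.
have D' (x y z : 'I_n) : x != y -> x != z -> y != z ->
    [set var true x; var true y; var false z] :\ var true x :\ var false z =
    [set var true y].
  by move=> *; rewrite (setUC [set var true x]) D // eq_sym.
have Duvw := D _ _ _ uv uw vw; have Duwv := D _ _ _ uw uv wv.
have Dvwu := D _ _ _ vw vu wu.
have D'uvw := D' _ _ _ uv uw vw; have D'uwv := D' _ _ _ uw uv wv.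
have D'vwu := D' _ _ _ vw vu wu.
rewrite !inE !eq_var !eqxx /= !orbF.
move: (uv) (uw) (vw) => /negPf uv' /negPf uw' /negPf vw'.
move: (vu) (wu) (wv) => /negPf vu' /negPf wu' /negPf wv'.
(* One case per position of [i] and [j] with respect to [u], [v], [w]. *)
move: ij {Gij}.
have [->|iu] := eqVneq i u;
  [|have [->|iv] := eqVneq i v; [|have [->|iw] := eqVneq i w]];
  (have [->|ju] := eqVneq j u;
    [|have [->|jv] := eqVneq j v; [|have [->|jw] := eqVneq j w]]);
  rewrite ?eqxx // => _; rewrite ?(uv', uw', vw', vu', wu', wv') ?andbF /=;
  rewrite ?Duvw ?Duwv ?Dvwu ?D'uvw ?D'uwv ?D'vwu;
  rewrite ?subrr ?subr0 ?sub0r ?addr0 ?add0r ?subrr ?addNr //.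
Qed.
End Functionals.

(** * Tensors attached to nonadjacent pairs *)

Section FrobeniusTensor.
Variables (k : fieldType) (char2 : 2%N \in [pchar k]) (n : nat).
Variables (G : simple_graph n).
Local Notation R := {mpoly k[n + n]}.
Local Notation J := (@binomial_edge_ideal k n G).
Local Notation A := (@binomial_edge_ring k n G).
Local Notation M := (coinduced A k).
Local Notation FA := (frobenius_pushforward (binomial_edge_ring_pchar G char2)).
Local Notation pi := (\pi_{ideal_quot J}).
Local Notation X := (@xvar k n).
Local Notation Y := (@yvar k n).
Implicit Types (f g : R) (b : bool) (i j u v w : 'I_n) (m : M).

Definition descend (l : R -> k) : M :=
  if pselect (descends G l) is left l_desc
  then sval (cid (descend_ex l_desc)) else 0.

Lemma descendE l : descends G l -> forall f, descend l (pi f) = l f.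
Proof.
rewrite /descend; case: pselect => // l_desc _ f.
by case: (cid _) => m /=.
Qed.

Definition ftensor m f : tensor M FA := tensor_pure m (pi f : FA).

Lemma ftensorD m m' f : ftensor (m + m') f = ftensor m f + ftensor m' f.
Proof. exact: tensor_pureDl. Qed.

Lemma ftensorZ g m f : ftensor (pi g *: m) f = ftensor m (g ^+ 2 * f).
Proof.
rewrite /ftensor tensor_pureZ; congr tensor_pure.
by rewrite [in RHS](rmorphM pi) (rmorphXn pi).
Qed.

Lemma ftensor_mod f g m : f - g \in J -> ftensor m f = ftensor m g.
Proof. by rewrite Quotient.idealrBE => /eqP E; rewrite /ftensor E. Qed.

Definition edge_mono u w : R := X u * Y u * (X w * Y w).

(** The functional [(x_u y_w)^*] tensored with [x_u y_u x_w y_w]. For a Frobenius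
    splitting [trace (c * _)], it evaluates to a square root of the coefficient in [c]
    of [x_u^2 y_w^2] times the product of the variables of the other vertices. *)
Definition pair_tensor u w :=
  ftensor (descend (pair_coeff true u w)) (edge_mono u w).

Definition unit_tensor := ftensor (descend (@sqfree_coeff k n set0)) 1.

Lemma edge_binomialM_in i j f : edge G i j -> f * edge_binomial k i j \in J.
Proof. by move=> Gij; apply: idealMr; apply: edge_binomial_in. Qed.

Lemma scale_descend l l' (z : 'I_(n + n)) : descends G l -> descends G l' ->
  (forall f, l ('X_z * f) = l' f) -> pi 'X_z *: descend l = descend l'.
Proof.
move=> dl dl' E; apply: coinduced_pi_inj => f.
by rewrite coinduced_scale_pi !descendE.
Qed.

Lemma pair_coeff_swap u w : pair_coeff (k := k) false u w = pair_coeff true w u.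
Proof. by rewrite /pair_coeff /= setUC. Qed.

(** Both sides are the fork functional of [u], [v], [w] tensored with an element
    of [R_G]: the squares of [var b w] and [var b v] move across the tensor sign, and
    the resulting elements differ by a multiple of [f_(v,w)]. *)
Lemma fork_tensor b u v w :
    u != v -> u != w -> ~~ edge G u v -> ~~ edge G u w -> edge G v w ->
  ftensor (descend (pair_coeff b u v)) (edge_mono u v) =
  ftensor (descend (pair_coeff b u w)) (edge_mono u w).
Proof.
move=> uv uw nGuv nGuw Gvw.
have vw : v != w by apply: contraTneq Gvw => ->; rewrite edge_irrefl.
have d_fork := descends_fork k b uv uw vw nGuv nGuw.
have [b1 b2] := var_signs b.
move: (uv) (uw) (vw) => /negPf uv' /negPf uw' /negPf vw'.
have <- : pi 'X_(var b w) *: descend (fork_coeff b u v w) =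
    descend (pair_coeff b u v).
  apply: scale_descend => // [|f]; first exact: descends_pair.
  rewrite /fork_coeff /pair_coeff !sqfree_coeffX !inE !eq_var !eqxx ?b1 ?b2 /=.
  rewrite ![w == _]eq_sym uw' vw' /= add0r; congr (sqfree_coeff _ f).
  apply/setP=> z; rewrite !inE.
  case: (eqVneq z (var b w)) => [->|_]; last by rewrite ?andbF ?orbF.
  by rewrite ?eq_var ?b1 ?b2 ?(eq_sym w) ?uw' ?andbF.
have <- : pi 'X_(var b v) *: descend (fork_coeff b u v w) =
    descend (pair_coeff b u w).
  apply: scale_descend => // [|f]; first exact: descends_pair.
  rewrite /fork_coeff /pair_coeff !sqfree_coeffX !inE !eq_var !eqxx ?b1 ?b2 /=.
  rewrite ![v == _]eq_sym uv' [w == v]eq_sym vw' /= addr0; congr (sqfree_coeff _ f).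
  apply/setP=> z; rewrite !inE.
  case: (eqVneq z (var b v)) => [->|_]; last by rewrite ?andbF ?orbF.
  by rewrite ?eq_var ?b1 ?b2 ?(eq_sym v) ?uv' ?andbF.
rewrite !ftensorZ; apply: ftensor_mod.
pose c : R := (if b then - (X v * X w) else Y v * Y w) * (X u * Y u).
suff -> : 'X_(var b w) ^+ 2 * edge_mono u v - 'X_(var b v) ^+ 2 * edge_mono u w =
    c * edge_binomial k v w by exact: edge_binomialM_in.
rewrite /c /edge_mono /edge_binomial /var; case: b {d_fork b1 b2 c} => /=.
  by rewrite -!/(xvar _ _) ; ring.
by rewrite -!/(yvar _ _); ring.
Qed.


(** Again both sides come from one functional [h], the path functional:
    [x_v *: h] is the sum of [(x_u y_w)^*] and [(x_w y_u)^*], while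
    [x_u x_v y_w *: h] is the constant coefficient, and the two elements tensored
    with [h] agree modulo [f_(u,v)] and [f_(v,w)]. *)
Lemma path_tensor u v w :
    u != w -> ~~ edge G u w -> edge G u v -> edge G v w ->
  pair_tensor u w + pair_tensor w u = unit_tensor.
Proof.
move=> uw nGuw Guv Gvw.
have uv : u != v by apply: contraTneq Guv => ->; rewrite edge_irrefl.
have vw : v != w by apply: contraTneq Gvw => ->; rewrite edge_irrefl.
have d_path := descends_path k G uv uw vw.
have d_uw := descends_pair k true nGuw.
have d_wu : descends G (pair_coeff (k := k) true w u).
  by apply: descends_pair; rewrite edge_sym.
move: (uv) (uw) (vw) => /negPf uv' /negPf uw' /negPf vw'.
have [vu' [wu' wv']] : (v == u) = false /\ (w == u) = false /\ (w == v) = false.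
  by rewrite ![_ == u]eq_sym [w == v]eq_sym.
pose h := descend (path_coeff u v w).
have Eh : pi (X v) *: h =
    descend (pair_coeff true u w) + descend (pair_coeff true w u).
  apply: coinduced_pi_inj => f.
  rewrite coinduced_scale_pi descendE //.
  rewrite -[RHS]/(descend _ (pi f) + descend _ (pi f)) !descendE //.
  rewrite /path_coeff /pair_coeff -[X v]/('X_(var true v)) !sqfree_coeffX.
  rewrite !inE !eq_var !eqxx /=.
  rewrite vu' vw' /= addr0; congr (sqfree_coeff _ f + sqfree_coeff _ f);
    apply/setP=> z; rewrite !inE;
    by case: (eqVneq z (var true v)) => [->|_];
      rewrite ?eq_var ?vu' ?vw' ?andbF ?orbF.
have E1 : pi (X u * X v * Y w) *: h = descend (@sqfree_coeff k n set0).
  apply: coinduced_pi_inj => f.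
  rewrite coinduced_scale_pi !descendE //; last exact: descends_unit.
  rewrite -!mulrA /path_coeff -[X u]/('X_(var true u)).
  rewrite -[X v]/('X_(var true v)) -[Y w]/('X_(var false w)).
  rewrite !sqfree_coeffX !inE !eq_var !eqxx /= uv' uw' vu' vw' wu' wv' /= !addr0.
  congr (sqfree_coeff _ f); apply/setP=> z; rewrite !inE.
  by do 3![case: (z == _)].
rewrite /pair_tensor [edge_mono w u]mulrC -/(edge_mono u w) -ftensorD -Eh.
rewrite /unit_tensor -E1 !ftensorZ; apply: ftensor_mod.
have -> : X v ^+ 2 * edge_mono u w - (X u * X v * Y w) ^+ 2 * 1 =
    (- (X u * X v * X w * Y w)) * edge_binomial k u v
    + (- (X u ^+ 2 * X v * Y w)) * edge_binomial k v w.
  by rewrite /edge_mono /edge_binomial; ring.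
by rewrite rpredD // edge_binomialM_in.
Qed.

Lemma pair_tensor_double u w : pair_tensor u w + pair_tensor u w = 0.
Proof.
rewrite /pair_tensor -ftensorD.
have -> : descend (pair_coeff true u w) + descend (pair_coeff true u w) = 0.
  by apply: coinducedP => a /=; rewrite -mulr2n mulr2n_char2.
by apply: (addIr (ftensor 0 (edge_mono u w))); rewrite -ftensorD !add0r.
Qed.

Lemma F_pure_unit_tensor :
  F_pure (binomial_edge_ring_pchar G char2) -> unit_tensor <> 0.
Proof.
move=> /(_ M) pure E0.
have E : descend (@sqfree_coeff k n set0) = 0.
  apply: pure; rewrite /= (_ : frobenius_map _ _ = pi 1); last first.
    by rewrite rmorph1; apply: expr1n.
  rewrite -/(ftensor _ 1) -/(ftensor _ 1) -/unit_tensor E0.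
  by apply: (addIr (ftensor 0 1)); rewrite -ftensorD !add0r.
have := descendE (descends_unit k G) 1; rewrite E /= /sqfree_coeff mcoeff1.
rewrite (_ : _ == _) => [/esym/eqP|]; first by rewrite oner_eq0.
by apply/eqP/mnmP=> i; rewrite mnmE mnm0E inE.
Qed.

Definition nonadjacent : rel 'I_n := fun u w => (u != w) && ~~ edge G u w.

Lemma nonadjacent_sym : ssrbool.symmetric nonadjacent.
Proof. by move=> u w; rewrite /nonadjacent eq_sym edge_sym. Qed.

Lemma pair_tensor_swap u w :
  pair_tensor w u = ftensor (descend (pair_coeff false u w)) (edge_mono u w).
Proof. by rewrite pair_coeff_swap [edge_mono u w]mulrC. Qed.

Lemma forces_pair_tensor a a' : forces nonadjacent a a' ->
  pair_tensor a.1 a.2 = pair_tensor a'.1 a'.2.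
Proof.
case: a a' => [u v] [u' v'] /and3P[/= /andP[uv nGuv] /andP[u'v' nGu'v']].
rewrite /nonadjacent !negb_and !negbK.
case/orP=> /andP[/eqP E]; subst.
  by case/orP=> [/eqP-> //|Gvv]; apply: fork_tensor.
case/orP=> [/eqP-> //|Guu].
by rewrite !(pair_tensor_swap v'); apply: fork_tensor; rewrite // 1?eq_sym 1?edge_sym.
Qed.

Lemma class_pair_tensor a a' : same_class nonadjacent a a' ->
  pair_tensor a.1 a.2 = pair_tensor a'.1 a'.2.
Proof.
case/connectP=> p; elim: p a => [|c p IHp] a /= => [_ -> //|/andP[ac cp] lb].
by rewrite (forces_pair_tensor ac); apply: IHp.
Qed.

Lemma class_connect a a' : same_class nonadjacent a a' ->
  connect (edge G) a.1 a'.1 /\ connect (edge G) a.2 a'.2.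
Proof.
case/connectP=> p; elim: p a => [|c p IHp] a /= => [_ ->|/andP[ac cp] lb].
  by split; exact: connect0.
have [c1 c2] := IHp c cp lb.
case/and3P: ac => _ _; rewrite /nonadjacent !negb_and !negbK.
case/orP=> /andP[/eqP E]; rewrite ?E => step; split=> //.
- case/orP: step => [/eqP->//|Ge]; apply: connect_trans (connect1 Ge) c2.
- case/orP: step => [/eqP->//|Ge]; apply: connect_trans (connect1 Ge) c1.
Qed.

(** Induction along a path from [u]: its last step either completes a path
    [u - v - w], or is a forcing step, which changes neither summand. *)
Lemma connected_pair_tensor u w : nonadjacent u w -> connect (edge G) u w ->
  pair_tensor u w + pair_tensor w u = unit_tensor.
Proof.
move=> nuw /connectP[p]; elim/last_ind: p w nuw => [|p w' IHp] w nuw.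
  by move=> _ /= E; rewrite E /nonadjacent eqxx in nuw.
rewrite rcons_path last_rcons => /andP[up pw'] E; subst w'.
set v := last u p in pw'.
have [Guv|nGuv] := boolP (edge G u v).
  by case/andP: nuw => uw nGuw; apply: path_tensor pw'.
have [Euv|uv] := eqVneq u v.
  by case/andP: nuw => _; rewrite Euv pw'.
have nuv : nonadjacent u v by rewrite /nonadjacent uv.
rewrite -(IHp v nuv up erefl); congr (_ + _).
  apply/esym/(@forces_pair_tensor (u, v) (u, w)).
  by rewrite /forces /= eqxx nuv nuw /nonadjacent pw' andbF.
apply/esym/(@forces_pair_tensor (v, u) (w, u)).
by rewrite /forces /= eqxx !(nonadjacent_sym _ u) nuv nuw /nonadjacent pw' andbF orbT.
Qed.

(** If the classes of [(u, w)] and [(w, u)] coincided, [pair_tensor] would take the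
    same value on both, so that [unit_tensor] would be twice that value, which is
    [0] in characteristic 2. *)
Lemma F_pure_coherent : F_pure (binomial_edge_ring_pchar G char2) ->
  forall u w, nonadjacent u w -> ~~ same_class nonadjacent (u, w) (w, u).
Proof.
move=> /F_pure_unit_tensor unit_neq0 u w nuw; apply/negP => cls.
have [/= Cuw _] := class_connect cls.
apply: unit_neq0; rewrite -(connected_pair_tensor nuw Cuw).
by rewrite -(class_pair_tensor cls) pair_tensor_double.
Qed.

(** A labeling witnesses weak closedness as soon as it extends a partial order
    whose comparable pairs are the nonadjacent ones. *)
Lemma F_pure_weakly_closed :
  F_pure (binomial_edge_ring_pchar G char2) -> weakly_closed G.
Proof.
move=> /F_pure_coherent coh.
have o_irr : irreflexive (oriented nonadjacent).
  by move=> u; rewrite /oriented /nonadjacent eqxx.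
have [label label_bij label_mono] :=
  linear_extension o_irr (oriented_trans nonadjacent_sym coh).
exists label => // u v w Guv lt_uw lt_wv.
have o_lt x y : (label x < label y)%N -> nonadjacent x y -> oriented nonadjacent x y.
  move=> lt_xy /(oriented_total nonadjacent_sym coh)/orP[//|/label_mono].
  by rewrite ltnNge ltnW.
have ne x y : (label x < label y)%N -> x != y.
  by apply: contraTneq => ->; rewrite ltnn.
have [|nGuw] := boolP (edge G u w); first by left.
have [|nGwv] := boolP (edge G w v); first by right.
have o_uw : oriented nonadjacent u w by apply: o_lt; rewrite // /nonadjacent ne.
have o_wv : oriented nonadjacent w v by apply: o_lt; rewrite // /nonadjacent ne.
have := oriented_edge (oriented_trans nonadjacent_sym coh o_uw o_wv).
by rewrite /nonadjacent Guv andbF.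
Qed.

End FrobeniusTensor.

Local Close Scope quotient_scope.
Local Close Scope ring_scope.

Theorem theorem1 (k : fieldType) (char2 : 2%N \in [pchar k]%R)
    (n : nat) (G : simple_graph n) :
  weakly_closed G <-> F_pure (binomial_edge_ring_pchar G char2).
Proof. by split; [exact: weakly_closed_F_pure | exact: F_pure_weakly_closed]. Qed.
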